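(* If $T$ is a tree with $\alpha(T)>|V(T)|/2$, then $|core(T)\cap pend(T)|\geq 2$.
   Context: All graphs are finite, simple and undirected. A tree is a connected acyclic graph of order (number of vertices) greater than one. A set of vertices is stable if no two of its vertices are adjacent; a maximum stable set is a stable set of maximum cardinality, and $\alpha(G)$ denotes the cardinality of a maximum stable set of $G$. $core(G)$ denotes the intersection of all maximum stable sets of $G$. A vertex $v$ of $G$ is pendant if it has exactly one neighbor in $G$, and $pend(G)$ denotes the set of all pendant vertices of $G$. *)

(* Defs.v *)
From mathcomp Require Import all_boot.

Set Implicit Arguments.
Unset Strict Implicit.
Unset Printing Implicit Defensive.

Record sgraph := SGraph {
  vertex :> finType;
  adj : rel vertex;
  adj_sym : symmetric adj;
  adj_irr : irreflexive adj
}.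

Section Graph.
Variable G : sgraph.
Implicit Types (S : {set G}) (u v : G).

Definition connected := forall u v, connect (@adj G) u v.

(* The size bound is needed: for an edge uv, the sequence [:: u; v] also
   satisfies ucycle, but it is not a cycle of the graph. *)
Definition acyclic :=
  forall c : seq G, 2 < size c -> ~ ucycle (@adj G) c.

Definition is_tree := [/\ connected, acyclic & 1 < #|G|].

Definition stable S := [forall u in S, forall v in S, ~~ adj u v].

Definition maximum_stable S :=
  stable S && [forall S' : {set G}, stable S' ==> (#|S'| <= #|S|)].

Definition alpha := \max_(S : {set G} | stable S) #|S|.

Definition core : {set G} := \bigcap_(S : {set G} | maximum_stable S) S.

Definition neighbors v := [set u | adj v u].

Definition pend := [set v | #|neighbors v| == 1].

End Graph.

(* Main.v *)
Require Import Defs.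
From mathcomp Require Import all_boot.
From mathcomp Require Import zify.

(** The theorem follows from a deficient stable set: a stable set [X] with more
    elements than neighbours.  A maximum stable set is deficient as soon as
    [alpha T] exceeds half the order, so there is an inclusion-minimal
    deficient [X].

    Minimality puts [X] inside the core ([min_deficient_sub_core]).  Indeed,
    the proper subsets of [X] satisfy Hall's condition, so if a maximum stable
    set [W] missed a point of [X], trading [W :&: N(X)] for [X :\: W] would
    enlarge it.

    Deficiency forces at least two leaves in [X].  All edges leaving [X] live in
    the forest induced on [X :|: N(X)], which has fewer than
    [#|X| + #|N(X)| < 2 * #|X|] edges ([acyclic_arcs]).  Hence the degrees of
    the points of [X] sum to at most [2 * #|X| - 2]; no degree is 0 since the
    tree is connected with at least two vertices, so at least two of them
    are 1. *)

Set Implicit Arguments.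
Unset Strict Implicit.
Unset Printing Implicit Defensive.

(** * Neighbourhoods and stable sets *)

Section Graph.
Variable G : sgraph.
Implicit Types (S U W X : {set G}) (u v x y : G).

Definition nbhood X : {set G} := \bigcup_(x in X) neighbors x.

Lemma nbhoodP X v : reflect (exists2 x, x \in X & adj x v) (v \in nbhood X).
Proof.
apply: (iffP bigcupP) => [[x xX]|[x xX xv]]; first by rewrite inE; exists x.
by exists x; rewrite ?inE.
Qed.

Lemma nbhoodS S X : S \subset X -> nbhood S \subset nbhood X.
Proof.
move=> /subsetP SX; apply/subsetP => v /nbhoodP[x /SX xX xv].
by apply/nbhoodP; exists x.
Qed.

Lemma stableP S :
  reflect {in S &, forall u v, ~~ adj u v} (stable S).
Proof.
apply: (iffP forall_inP) => [H u v uS vS|H u uS].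
  by move/forall_inP: (H u uS) => /(_ v vS).
by apply/forall_inP => v vS; apply: H.
Qed.

Lemma stable_sub S X : S \subset X -> stable X -> stable S.
Proof.
move=> /subsetP SX /stableP stX; apply/stableP => u v /SX uX /SX vX.
exact: stX.
Qed.

Lemma stable_nbhood_disjoint S : stable S -> [disjoint S & nbhood S].
Proof.
move=> /stableP stS; apply/pred0P => v /=; apply/negP => /andP[vS].
by case/nbhoodP => x xS xv; have := stS x v xS vS; rewrite xv.
Qed.

Lemma alpha_witness : exists2 S : {set G}, stable S & #|S| = alpha G.
Proof.
have st0 : @stable G set0 by apply/stableP => u v; rewrite inE.
have [|S stS maxS] := eq_bigmax_cond (A := @stable G) (fun S : {set G} => #|S|).
  by apply/card_gt0P; exists set0.
by exists S; last exact: esym maxS.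
Qed.

(** * Deficient stable sets and the core *)

Definition deficient X := stable X && (#|nbhood X| < #|X|).

Lemma deficient_exists : #|G| < 2 * alpha G -> exists X, deficient X.
Proof.
have [S stS <-] := alpha_witness; move=> ltG; exists S.
rewrite /deficient stS /=.
have := stable_nbhood_disjoint stS.
rewrite -setI_eq0 => /eqP dis; have := cardsUI S (nbhood S).
by rewrite dis cards0; have := max_card (S :|: nbhood S); lia.
Qed.

(** The exchange replaces [W] by [(W :\: N(X)) :|: X].  It loses only points of
    [N(X)] that are not neighbours of [X :&: W], that is, at most
    [#|N(X)| - #|N(X :&: W)|] of them, and it gains [#|X| - #|X :&: W|].  If
    [X :&: W] is a proper subset of [X] then it is not deficient, and the
    gain exceeds the loss. *)
Lemma min_deficient_sub_core X : minset deficient X -> X \subset core G.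
Proof.
case/minsetP => /andP[stX defX] minX.
apply/bigcapsP => W /andP[/[dup] stW /stableP stWP /forall_inP maxW].
apply/setIidPl; apply: minX (subsetIl _ _).
rewrite /deficient (stable_sub (subsetIl X W) stX) /= ltnNge.
apply/negP => hall.
have disX := stable_nbhood_disjoint stX.
have stW' : stable ((W :\: nbhood X) :|: X).
  have cross u v : u \in X -> v \notin nbhood X -> ~~ adj u v.
    by move=> uX; apply: contra => uv; apply/nbhoodP; exists u.
  apply/stableP => u v; rewrite !inE.
  case/orP=> [/andP[uN uW]|uX] /orP[/andP[vN vW]|vX].
  - exact: stWP.
  - by rewrite adj_sym; apply: cross.
  - exact: cross.
  - by move/stableP: stX; apply.
have loss : #|W :&: nbhood X| <= #|nbhood X| - #|nbhood (X :&: W)|.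
  rewrite -(cardsDS (nbhoodS (subsetIl X W))).
  apply/subset_leq_card/subsetP => v; rewrite !inE => /andP[vW ->].
  rewrite andbT; apply/negP => /nbhoodP[x].
  by rewrite inE => /andP[_ xW]; apply/negP/stWP.
have le_nb := subset_leq_card (nbhoodS (subsetIl X W)).
have meet : (W :\: nbhood X) :&: X = X :&: W.
  apply/setP => v; rewrite !inE; case vX: (v \in X); rewrite ?andbF //= andbT.
  by rewrite (disjointFr disX vX).
have := maxW _ stW'; have := cardsUI (W :\: nbhood X) X; rewrite meet.
by have := cardsID (nbhood X) W; lia.
Qed.

(** * Edges of a forest *)

(** Were every vertex of [U] to have two neighbours in [U], a simple path in [U]
    could be prolonged indefinitely at its head [x]: some neighbour of [x] in
    [U] differs from the second vertex [y], and it cannot lie further down the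
    path without closing a cycle. *)
Lemma acyclic_low_degree U :
  acyclic G -> U != set0 -> exists2 u, u \in U & #|neighbors u :&: U| <= 1.
Proof.
move=> acG /set0Pn[u0 u0U]; apply/exists_inP; apply: contraT.
rewrite negb_exists_in => /forall_inP big.
have step x y : x \in U -> exists z, [/\ z \in U, adj x z & z != y].
  move=> xU; have := big x xU; rewrite -ltnNge => /card_gt1P[a [b []]].
  rewrite !inE => /andP[xa aU] /andP[xb bU] ab.
  case: (eqVneq a y) => [eay|nay]; last by exists a.
  by exists b; split=> //; rewrite -eay eq_sym.
have long n : exists x y s,
    [/\ x \in U, uniq [:: x, y & s], path (@adj G) x (y :: s) & size s = n].
  elim: n => [|n [x [y [s [xU Us ps szs]]]]].
    have [z [zU uz _]] := step u0 u0 u0U.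
    exists z, u0, [::]; split=> //=; last by rewrite andbT adj_sym.
    by rewrite inE andbT; apply: contraTneq uz => ->; rewrite adj_irr.
  have [z [zU xz zy]] := step x y xU.
  have zx : z != x by apply: contraTneq xz => ->; rewrite adj_irr.
  case zs: (z \in s).
    (* the path from x down to z, closed by the edge zx *)
    case/splitPr: zs Us ps => s1 s2 Us ps.
    case: (acG [:: x, y & rcons s1 z]); first by rewrite /= size_rcons.
    move: Us ps; rewrite -cat_rcons -!cat_cons cat_uniq => /andP[Us _].
    rewrite cat_path => /andP[ps _].
    rewrite /ucycle Us andbT /= rcons_path last_rcons (adj_sym z) xz andbT.
    exact: ps.
  exists z, x, (y :: s); split=> //=; last by rewrite szs.
    by rewrite in_cons (negPf zx) in_cons (negPf zy) zs.
  by rewrite adj_sym xz.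
have [x [y [s [_ /card_uniqP Us _ szs]]]] := long #|G|.
have : size [:: x, y & s] <= #|G| by rewrite -Us max_card.
by rewrite /= szs => /ltnW; rewrite ltnn.
Qed.

Lemma card_setI_sum U W : #|U :&: W| = \sum_(u in U) (u \in W).
Proof.
rewrite -sum1_card big_mkcond [RHS]big_mkcond /=; apply: eq_bigr => u _.
by rewrite inE; case: (u \in U); case: (u \in W).
Qed.

Lemma card_neighborsI v U : #|neighbors v :&: U| = \sum_(w in U) adj v w.
Proof.
by rewrite setIC card_setI_sum; apply: eq_bigr => w _; rewrite inE.
Qed.

(** A forest on [m > 0] vertices has at most [m - 1] edges, each of which is
    counted from both ends; removing a vertex of degree at most 1 removes at
    most two of these arcs. *)
Lemma acyclic_arcs U :
  acyclic G -> U != set0 ->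
  \sum_(u in U) #|neighbors u :&: U| <= (#|U|.-1).*2.
Proof.
move=> acG; have [n] := ubnP #|U|; elim: n U => // n IHn U ltUn U0.
have [u uU degu] := acyclic_low_degree acG U0.
have cardU := cardsD1 u U; rewrite uU in cardU.
have drop v : #|neighbors v :&: U| = adj v u + #|neighbors v :&: (U :\ u)|.
  by rewrite (cardsD1 u) setIDA !inE uU andbT.
have at_u : \sum_(v in U :\ u) adj v u <= 1.
  apply: leq_trans degu; rewrite drop adj_irr add0n card_neighborsI.
  by apply: leq_sum => v _; rewrite adj_sym.
rewrite (big_setD1 u) //= (eq_bigr _ (fun v _ => drop v)) big_split /=.
have [/eqP|U'0] := eqVneq (U :\ u) set0.
  rewrite setD_eq0 => Uu; move: degu; rewrite drop adj_irr add0n.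
  have -> : U :\ u = set0 by apply/eqP; rewrite setD_eq0.
  by rewrite setI0 cards0 !big_set0.
have := IHn _ _ U'0; have : 0 < #|U :\ u| by rewrite card_gt0.
by lia.
Qed.

(** The arcs inside [X :|: N(X)] comprise all those leaving [X] and, [X] being
    disjoint from [N(X)], as many again in the opposite direction. *)
Lemma acyclic_degree_sum X :
  acyclic G -> stable X -> X != set0 ->
  \sum_(x in X) #|neighbors x| <= #|X :|: nbhood X|.-1.
Proof.
move=> acG stX X0; set N := nbhood X; set U := X :|: N.
have disX : [disjoint X & N] := stable_nbhood_disjoint stX.
have U0 : U != set0.
  by apply: contra_neq X0 => /eqP; rewrite setU_eq0 => /andP[/eqP].
have nbN x : x \in X -> neighbors x \subset N.
  by move=> xX; apply: (bigcup_sup x).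
have from_X : \sum_(x in X) #|neighbors x :&: U| = \sum_(x in X) #|neighbors x|.
  apply: eq_bigr => x xX; congr #|pred_of_set _|; apply/setIidPl.
  exact: subset_trans (nbN x xX) (subsetUr _ _).
have from_N :
    \sum_(x in X) #|neighbors x| <= \sum_(y in N) #|neighbors y :&: U|.
  have -> : \sum_(x in X) #|neighbors x| = \sum_(y in N) #|neighbors y :&: X|.
    under [RHS]eq_bigr => y _ do rewrite card_neighborsI.
    rewrite exchange_big /=; apply: eq_bigr => x xX.
    rewrite -(setIidPl (nbN x xX)) card_neighborsI.
    by apply: eq_bigr => y _; rewrite adj_sym.
  by apply: leq_sum => y _; apply/subset_leq_card/setIS/subsetUl.
have := acyclic_arcs acG U0.
rewrite (eq_bigl [predU X & N]); last by move=> u; rewrite !inE.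
rewrite bigU //= from_X => arcs; rewrite -leq_double -addnn.
by apply: leq_trans arcs; rewrite leq_add2l.
Qed.

(** * Leaves of a tree in a deficient set *)

Lemma connected_degree_gt0 v : connected G -> 1 < #|G| -> 0 < #|neighbors v|.
Proof.
move=> conG G_gt1; have /card_gt0P[u] : 0 < #|[set~ v]|.
  by have := cardsC1 v; lia.
rewrite !inE => uv; have /connectP[[|w p] /=] := conG v u.
  by move=> _ euv; rewrite euv eqxx in uv.
by case/andP=> vw _ _; apply/card_gt0P; exists w; rewrite inE.
Qed.

(** If at most one point of [X] were a leaf, the degrees in [X] would sum to at
    least [2 * #|X| - 1], whereas deficiency bounds the sum by
    [2 * #|X| - 2]. *)
Lemma deficient_two_leaves X :
  is_tree G -> deficient X -> 1 < #|X :&: pend G|.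
Proof.
case=> conG acG G_gt1 /andP[stX defX].
have X0 : X != set0 by rewrite -card_gt0; lia.
have := acyclic_degree_sum acG stX X0.
have : 2 * #|X| <= \sum_(x in X) #|neighbors x| + #|X :&: pend G|.
  rewrite card_setI_sum -big_split /= mulnC -sum_nat_const.
  apply: leq_sum => x _.
  by rewrite inE; have := connected_degree_gt0 x conG G_gt1; lia.
by have := cardsU X (nbhood X); lia.
Qed.

End Graph.

Theorem theorem3p3 (T : sgraph) (hT : is_tree T) (halpha : #|T| < 2 * alpha T) :
  2 <= #|core T :&: pend T|.
Proof.
have [X0 defX0] := deficient_exists halpha.
have [X minX _] := minset_exists defX0.
apply: leq_trans (deficient_two_leaves hT (minsetp minX)) _.
exact/subset_leq_card/setSI/min_deficient_sub_core.
Qed.
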